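(* Consider the joint dynamics $q_t=(q_t^x,q_t^y,q_t^\theta)$, $t=0,\dots,T-1$, with true model parameters $a_{0:T-1}^*$ and estimates $\hat a_{0:T-1}$ in $\mathcal A$, and suppose that the Lipschitzness, Contraction Stability and Robustness properties stated in the context hold, with constants $\alpha_x,\alpha_y,\alpha_\theta,\beta_x,\beta_y,\beta_\theta,L_{\theta,x},L_{\theta,y},R_x,R_y,R_x^*,R_y^*,C,\epsilon_\theta,\bar\zeta$ and regret bound $R(\cdot,\cdot)$. Let $\xi=\{(x_t,y_t,\theta_t)\}$ be the trajectory of the meta-framework, i.e. $(x_{t+1},y_{t+1},\theta_{t+1})=q_t(x_t,y_t,\theta_t,\hat a_t)$ for $t=0,\dots,T-1$, and write $\varepsilon_t=\varepsilon_t(x_t,\hat a_t,a_t^* )$, $\varepsilon_t'=\varepsilon_t'(x_t,\hat a_t,a_t^* )$ along $\xi$. Suppose that for all time steps $t$, $$\alpha_\theta\varepsilon_t+\beta_\theta\varepsilon_t'\le \bar\zeta/2,\qquad (\alpha_x+\alpha_y)\varepsilon_t+(\beta_x+\beta_y)\varepsilon_t'\le \min\left\{\frac{\sqrt2\,\bar\zeta}{4(L_{\theta,x}+L_{\theta,y})C},\ \frac{\min\{R_x-R_x^*,\,R_y-R_y^*\}}{C}\right\}.$$ Then $\xi$ satisfies $\|x_t\|\le R_x$, $\|y_t\|\le R_y$ and $\|\theta_t-\theta_{t-1}\|\le\epsilon_\theta$ for all time steps $t$. Further, let $\tilde\xi=\{(\tilde x_t,\tilde y_t,\theta_t)\}$,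 where $\theta_{0:T-1}$ are the policy parameters of $\xi$ and $(\tilde x_t,\tilde y_t)$ is obtained by implementing them with the exact model parameters $a^*_{0:T-1}$: $\tilde x_{t+1}=q_t^x(\tilde x_t,\tilde y_t,\theta_t,a_t^* )$, $\tilde y_{t+1}=q_t^y(\tilde x_t,\tilde y_t,\theta_t,a_t^* )$, from the same initial state $(\tilde x_0,\tilde y_0)=(x_0,y_0)$. Let $\zeta_t=\theta_{t+1}-q_t^\theta(\tilde x_t,\tilde y_t,\theta_t,a_t^* )$, so that $\tilde\xi$ is a trajectory of the perturbed exact-parameter dynamics $( * )$ of the context. Then $\tilde\xi$ achieves the regret $R\big(T,\sum_{t=0}^{T-1}\|\zeta_t\|\big)$, with $$\sum_{t=0}^{T-1}\|\zeta_t\|\le \Big(\alpha_\theta+\sqrt2\,C(L_{\theta,x}+L_{\theta,y})(\alpha_x+\alpha_y)\Big)\sum_{t=0}^{T-1}\varepsilon_t+\Big(\beta_\theta+\sqrt2\,C(L_{\theta,x}+L_{\theta,y})(\beta_x+\beta_y)\Big)\sum_{t=0}^{T-1}\varepsilon_t'.$$ Moreover, $$\sum_{t=1}^{T}\|(x_t,y_t)-(\tilde x_t,\tilde y_t)\|\le C\left((\alpha_x+\alpha_y)\sum_{t=0}^{T-1}\varepsilon_t+(\beta_x+\beta_y)\sum_{t=0}^{T-1}\varepsilon_t'\right).$$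
   Context: Norms are Euclidean; $\|\cdot\|_F$ is the Frobenius norm. $\Theta\subseteq\mathbb R^d$ is closed and convex; $\mathcal A$ is a subset of a Euclidean space. Known functions $f_t(x,a)\in\mathbb R^k$ (differentiable in $x\in\mathbb R^n$) define the zeroth- and first-order model mismatches $$\varepsilon_t(x,\hat a,a^* )=\|f_t(x,\hat a)-f_t(x,a^* )\|,\qquad \varepsilon_t'(x,\hat a,a^* )=\|\nabla_xf_t(x,\hat a)-\nabla_xf_t(x,a^* )\|_F.$$ The joint dynamics of the controlled system and the online policy optimization algorithm is a sequence of maps $q_t(x,y,\theta,a)=(q_t^x,q_t^y,q_t^\theta)(x,y,\theta,a)$, where $x\in\mathbb R^n$ is the system state, $y$ (in a Euclidean space) is the internal state of the algorithm, $\theta\in\Theta$ is the policy parameter, and $a\in\mathcal A$ is the model parameter supplied to the algorithm (external disturbances are absorbed in $q_t$). The true parameters are $a_t^*\in\mathcal A$. The meta-framework runs the algorithm with the estimates $\hat a_t$ produced online by a parameter estimator, starting from an initial state $x_0$, internal state $y_0$ and policy parameter $\theta_0\in\Theta$. The exact-parameter dynamics with perturbations $\zeta_t\in\mathbb R^d$ is $$(x_{t+1},y_{t+1},\theta_{t+1})=q_t(x_t,y_t,\theta_t,a_t^* )+(0,0,\zeta_t).\qquad( * )$$ Lipschitzness: for all $t$ and all $\|x\|\le R_x$, $\|y\|\le R_y$, $\theta\in\Theta$, $\hat a\in\mathcal A$, for each of $\bullet\in\{x,y,\theta\}$, $$\|q_t^\bullet(x,y,\theta,a_t^* )-q_t^\bullet(x,y,\theta,\hat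 a)\|\le\alpha_\bullet\,\varepsilon_t(x,\hat a,a_t^* )+\beta_\bullet\,\varepsilon_t'(x,\hat a,a_t^* );$$ and $q_t^\theta(x,y,\theta,a_t^* )$ is $(L_{\theta,x},L_{\theta,y})$-Lipschitz in $(x,y)$, i.e. $\|q_t^\theta(x,y,\theta,a_t^* )-q_t^\theta(x',y',\theta,a_t^* )\|\le L_{\theta,x}\|x-x'\|+L_{\theta,y}\|y-y'\|$. Contraction Stability: for any sequence $\theta_{0:T-1}$ with $\|\theta_t-\theta_{t-1}\|\le\epsilon_\theta$ for all $t$, consider the partial system $x_{t+1}=q_t^x(x_t,y_t,\theta_t,a_t^* )$, $y_{t+1}=q_t^y(x_t,y_t,\theta_t,a_t^* )$. If it starts from $(x_\tau,y_\tau)=(0,0)$, then $\|x_t\|\le R_x^*<R_x$ and $\|y_t\|\le R_y^*<R_y$ always hold. Further, for some $\gamma:\mathbb Z_{\ge0}\to\mathbb R_{\ge0}$ with $\sum_{t=0}^\infty\gamma(t)\le C$, any two trajectories started at time $\tau$ from $(x_\tau,y_\tau)$, $(x_\tau',y_\tau')$ with $\|x_\tau\|,\|x'_\tau\|\le R_x$, $\|y_\tau\|,\|y_\tau'\|\le R_y$ satisfy $\|(x_{\tau+t},y_{\tau+t})-(x'_{\tau+t},y'_{\tau+t})\|\le\gamma(t)\|(x_\tau,y_\tau)-(x_\tau',y_\tau')\|$. Robustness: whenever $\|\zeta_t\|\le\bar\zeta$ for all $t$, the sequence $\{\theta_t\}$ generated by $( * )$ satisfies $\|\theta_t-\theta_{t-1}\|\le\epsilon_\theta$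 for all $t$; further, $( * )$ achieves a regret guarantee $R(T,\sum_{t=0}^{T-1}\|\zeta_t\|)$ depending on the total magnitude of the perturbations. Here ''regret'' may be any regret functional of the trajectory, and ''achieves the regret $R(T,s)$'' means that the functional evaluated at the trajectory is at most $R(T,s)$.
   Formalization: Added assumption: the exact partial system started from (x_0,y_0) at time 0 also satisfies the R_x^*, R_y^* bounds (automatic for (0,0)); without it the claim fails, e.g. if ‖x_0‖>R_x. Also made explicit: q_t maps Θ to Θ, and L_{θ,x}, L_{θ,y}, ε_θ, ζ̄ are nonnegative. *)

(* Defs.v *)
(* MathComp + MathComp-Analysis *)
From HB Require Import structures.
From mathcomp Require Export all_boot all_order all_algebra.
From mathcomp Require Export all_classical all_reals all_analysis.
Set Implicit Arguments.
Unset Strict Implicit.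
Unset Printing Implicit Defensive.
Import Order.TTheory GRing.Theory Num.Theory.
Import numFieldNormedType.Exports.
Local Open Scope classical_set_scope.
Local Open Scope ring_scope.

(* Frobenius norm; on row vectors 'rV_n it is the Euclidean norm.  The norm `|A|
   of the library on matrices is the sup norm, hence this definition. *)
Definition fnorm (R : realType) (m n : nat) (A : 'M[R]_(m, n)) : R :=
  Num.sqrt (\sum_(i < m) \sum_(j < n) A i j ^+ 2).

Definition mismatch (R : realType) (n p k : nat)
    (f : nat -> 'rV[R]_n -> 'rV[R]_p -> 'rV[R]_k)
    (t : nat) (x : 'rV[R]_n) (ahat astar : 'rV[R]_p) : R :=
  fnorm (f t x ahat - f t x astar).

Definition mismatch' (R : realType) (n p k : nat)
    (f : nat -> 'rV[R]_n -> 'rV[R]_p -> 'rV[R]_k)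
    (t : nat) (x : 'rV[R]_n) (ahat astar : 'rV[R]_p) : R :=
  fnorm (jacobian (fun z => f t z ahat) x - jacobian (fun z => f t z astar) x).

Record dynamics (R : realType) (n m d p : nat) := Dynamics {
  qx : nat -> 'rV[R]_n -> 'rV[R]_m -> 'rV[R]_d -> 'rV[R]_p -> 'rV[R]_n ;
  qy : nat -> 'rV[R]_n -> 'rV[R]_m -> 'rV[R]_d -> 'rV[R]_p -> 'rV[R]_m ;
  qth : nat -> 'rV[R]_n -> 'rV[R]_m -> 'rV[R]_d -> 'rV[R]_p -> 'rV[R]_d }.

(* The maps of [dynamics] are total; this says that q_t sends policy parameters
   in Theta to policy parameters in Theta. *)
Definition preserves_Theta (R : realType) (n m d p : nat) (T : nat)
    (q : dynamics R n m d p) (Theta : set 'rV[R]_d) (A : set 'rV[R]_p) : Prop :=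
  forall t x y th a, (t < T)%N -> Theta th -> A a -> Theta (qth q t x y th a).
Arguments preserves_Theta {R n m d p} T q Theta A.

Definition lipschitzness (R : realType) (n m d p k : nat) (T : nat)
    (f : nat -> 'rV[R]_n -> 'rV[R]_p -> 'rV[R]_k)
    (q : dynamics R n m d p) (Theta : set 'rV[R]_d) (A : set 'rV[R]_p)
    (astar : nat -> 'rV[R]_p)
    (alx aly alth bex bey beth Lx Ly Rx Ry : R) : Prop :=
  (forall t x y th ahat, (t < T)%N ->
     fnorm x <= Rx -> fnorm y <= Ry -> Theta th -> A ahat ->
     [/\ fnorm (qx q t x y th (astar t) - qx q t x y th ahat)
           <= alx * mismatch f t x ahat (astar t)
              + bex * mismatch' f t x ahat (astar t),
         fnorm (qy q t x y th (astar t) - qy q t x y th ahat)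
           <= aly * mismatch f t x ahat (astar t)
              + bey * mismatch' f t x ahat (astar t)
       & fnorm (qth q t x y th (astar t) - qth q t x y th ahat)
           <= alth * mismatch f t x ahat (astar t)
              + beth * mismatch' f t x ahat (astar t)]) /\
  (forall t x y x' y' th, (t < T)%N ->
     fnorm x <= Rx -> fnorm y <= Ry -> fnorm x' <= Rx -> fnorm y' <= Ry ->
     Theta th ->
     fnorm (qth q t x y th (astar t) - qth q t x' y' th (astar t))
       <= Lx * fnorm (x - x') + Ly * fnorm (y - y')).
Arguments lipschitzness {R n m d p k} T f q Theta A astar alx aly alth bex bey
  beth Lx Ly Rx Ry.

(* Only th 0, ..., th T.-1 are constrained. *)
Definition slowly_varying (R : realType) (d : nat) (T : nat)
    (Theta : set 'rV[R]_d) (eps_th : R) (th : nat -> 'rV[R]_d) : Prop :=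
  (forall t, (t < T)%N -> Theta (th t)) /\
  (forall t, (t.+1 < T)%N -> fnorm (th t.+1 - th t) <= eps_th).
Arguments slowly_varying {R d} T Theta eps_th th.

(* Trajectory, from time tau to time T, of the partial system driven by th and
   the exact model parameters. *)
Definition partial_traj (R : realType) (n m d p : nat) (T : nat)
    (q : dynamics R n m d p) (astar : nat -> 'rV[R]_p) (th : nat -> 'rV[R]_d)
    (tau : nat) (x : nat -> 'rV[R]_n) (y : nat -> 'rV[R]_m) : Prop :=
  forall t, (tau <= t < T)%N ->
    x t.+1 = qx q t (x t) (y t) (th t) (astar t) /\
    y t.+1 = qy q t (x t) (y t) (th t) (astar t).
Arguments partial_traj {R n m d p} T q astar th tau x y.

(* Under every slowly varying policy sequence, the exact partial system started
   from (xi, yi) at time tau stays in the balls of radii Rxs and Rys. *)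
Definition stable_from (R : realType) (n m d p : nat) (T : nat)
    (q : dynamics R n m d p) (Theta : set 'rV[R]_d) (astar : nat -> 'rV[R]_p)
    (eps_th Rxs Rys : R) (tau : nat) (xi : 'rV[R]_n) (yi : 'rV[R]_m) : Prop :=
  forall th x y, slowly_varying T Theta eps_th th ->
    partial_traj T q astar th tau x y -> x tau = xi -> y tau = yi ->
    forall t, (tau <= t <= T)%N -> fnorm (x t) <= Rxs /\ fnorm (y t) <= Rys.
Arguments stable_from {R n m d p} T q Theta astar eps_th Rxs Rys tau xi yi.

(* The Euclidean norm of a pair (x, y) is that of [row_mx x y]. *)
Definition contraction_stability (R : realType) (n m d p : nat) (T : nat)
    (q : dynamics R n m d p) (Theta : set 'rV[R]_d) (astar : nat -> 'rV[R]_p)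
    (eps_th Rx Ry Rxs Rys C : R) : Prop :=
  [/\ Rxs < Rx, Rys < Ry,
      forall tau, (tau <= T)%N ->
        stable_from T q Theta astar eps_th Rxs Rys tau 0 0
    & exists gamma : nat -> R,
        [/\ forall t, 0 <= gamma t,
            (\sum_(0 <= t <oo) (gamma t)%:E <= C%:E)%E
          & forall th tau x y x' y', slowly_varying T Theta eps_th th ->
              partial_traj T q astar th tau x y ->
              partial_traj T q astar th tau x' y' ->
              fnorm (x tau) <= Rx -> fnorm (x' tau) <= Rx ->
              fnorm (y tau) <= Ry -> fnorm (y' tau) <= Ry ->
              forall t, (tau + t <= T)%N ->
                fnorm (row_mx (x (tau + t)%N) (y (tau + t)%N)
                       - row_mx (x' (tau + t)%N) (y' (tau + t)%N))
                <= gamma t * fnorm (row_mx (x tau) (y tau)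
                                    - row_mx (x' tau) (y' tau))]].
Arguments contraction_stability {R n m d p} T q Theta astar eps_th Rx Ry Rxs Rys C.

(* The exact-parameter dynamics with perturbations zeta of the policy
   parameter; as q_t is defined for policy parameters in Theta, a trajectory
   has all its policy parameters in Theta. *)
Definition perturbed_traj (R : realType) (n m d p : nat) (T : nat)
    (q : dynamics R n m d p) (Theta : set 'rV[R]_d) (astar : nat -> 'rV[R]_p)
    (zeta : nat -> 'rV[R]_d) (x : nat -> 'rV[R]_n) (y : nat -> 'rV[R]_m)
    (th : nat -> 'rV[R]_d) : Prop :=
  (forall t, (t <= T)%N -> Theta (th t)) /\
  (forall t, (t < T)%N ->
     [/\ x t.+1 = qx q t (x t) (y t) (th t) (astar t),
         y t.+1 = qy q t (x t) (y t) (th t) (astar t)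
       & th t.+1 = qth q t (x t) (y t) (th t) (astar t) + zeta t]).
Arguments perturbed_traj {R n m d p} T q Theta astar zeta x y th.

(* [Reg] is an arbitrary functional of the trajectory at times 0, ..., T. *)
Definition robustness (R : realType) (n m d p : nat) (T : nat)
    (q : dynamics R n m d p) (Theta : set 'rV[R]_d) (astar : nat -> 'rV[R]_p)
    (x0 : 'rV[R]_n) (y0 : 'rV[R]_m) (th0 : 'rV[R]_d) (eps_th zbar : R)
    (Reg : ('I_T.+1 -> 'rV[R]_n * 'rV[R]_m * 'rV[R]_d) -> R)
    (Rbound : nat -> R -> R) : Prop :=
  forall zeta x y th, x 0%N = x0 -> y 0%N = y0 -> th 0%N = th0 ->
    perturbed_traj T q Theta astar zeta x y th ->
    (forall t, (t < T)%N -> fnorm (zeta t) <= zbar) ->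
    (forall t, (t < T)%N -> fnorm (th t.+1 - th t) <= eps_th) /\
    Reg (fun t => (x t, y t, th t))
      <= Rbound T (\sum_(t < T) fnorm (zeta t)).
Arguments robustness {R n m d p} T q Theta astar x0 y0 th0 eps_th zbar Reg Rbound.

Lemma stable_from_zero (R : realType) (n m d p : nat) (T : nat)
    (q : dynamics R n m d p) (Theta : set 'rV[R]_d) (astar : nat -> 'rV[R]_p)
    (eps_th Rx Ry Rxs Rys C : R) :
  contraction_stability T q Theta astar eps_th Rx Ry Rxs Rys C ->
  stable_from T q Theta astar eps_th Rxs Rys 0 0 0.
Proof. by case=> _ _ + _; apply. Qed.

(* Main.v *)
Require Import Defs.
From mathcomp Require Import ring lra.
Set Implicit Arguments.
Unset Strict Implicit.
Unset Printing Implicit Defensive.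
Import Order.TTheory GRing.Theory Num.Theory.
Import numFieldNormedType.Exports.
Local Open Scope classical_set_scope.
Local Open Scope ring_scope.

(* The trajectory of the meta-framework is compared with the exact partial system
   driven by the same policy parameters.  Restarting the exact system from each
   visited state (x_j, y_j) splits the deviation at time t into one-step errors
   e_i = (alpha_x + alpha_y) eps_i + (beta_x + beta_y) eps'_i, each contracted over
   the remaining time, so it is at most sum_(i < t) gamma (t - 1 - i) e_i; this also
   keeps all restarted trajectories inside the balls where contraction applies.
   That argument presupposes slowly varying policy parameters, which Robustness
   yields only once zeta is small, i.e. once the deviation is small.  The circle is
   broken by induction on the horizon S: policy parameters that vary slowly before
   time S can be frozen from then on, so Contraction Stability applies up to S + 1,
   bounds zeta there, and Robustness, with the later perturbations switched off,
   shows that they vary slowly up to S + 1. *)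

(** * Cauchy-Schwarz and the triangle inequality for the Frobenius norm *)

Section FrobeniusNorm.
Variable R : realType.

(** Cauchy-Schwarz. The sum of the squares of [b * u i - c * v i] equals [b * (a * b - c ^+ 2)], and
    [b] can be cancelled unless [v] vanishes. *)
Lemma sum_mul_sqr_le (I : finType) (u v : I -> R) :
  (\sum_i u i * v i) ^+ 2 <= (\sum_i u i ^+ 2) * (\sum_i v i ^+ 2).
Proof.
set c := \sum_i u i * v i; set a := \sum_i u i ^+ 2; set b := \sum_i v i ^+ 2.
have b0 : 0 <= b by apply: sumr_ge0 => i _; exact: sqr_ge0.
have : 0 <= \sum_i (b * u i - c * v i) ^+ 2 by apply: sumr_ge0 => i _; exact: sqr_ge0.
have -> : \sum_i (b * u i - c * v i) ^+ 2 = b * (a * b - c ^+ 2).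
  have E i : (b * u i - c * v i) ^+ 2 = b ^+ 2 * u i ^+ 2
      - (2 * b * c) * (u i * v i) + c ^+ 2 * v i ^+ 2 by ring.
  rewrite (eq_bigr _ (fun i _ => E i)) big_split sumrB -!mulr_sumr /= -/a -/b -/c.
  by ring.
case: (ltP 0 b) => [b_gt0|b_le0]; first by rewrite pmulr_rge0 // subr_ge0.
move=> _; have bE : b = 0 by apply/le_anti/andP.
have v0 i : v i = 0.
  apply/eqP; rewrite -sqrf_eq0; apply/eqP.
  by apply: (psumr_eq0P _ bE) => // j _; exact: sqr_ge0.
by rewrite bE mulr0 /c big1 ?expr0n // => i _; rewrite v0 mulr0.
Qed.

(** Minkowski: after squaring, only the cross term remains, and Cauchy-Schwarz bounds it. *)
Lemma sqrt_sum_sqrD (I : finType) (u v : I -> R) :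
  Num.sqrt (\sum_i (u i + v i) ^+ 2)
  <= Num.sqrt (\sum_i u i ^+ 2) + Num.sqrt (\sum_i v i ^+ 2).
Proof.
have sum_ge0 (w : I -> R) : 0 <= \sum_i w i ^+ 2.
  by apply: sumr_ge0 => i _; exact: sqr_ge0.
set a := \sum_i u i ^+ 2; set b := \sum_i v i ^+ 2.
have sab : 0 <= Num.sqrt a + Num.sqrt b by rewrite addr_ge0 ?sqrtr_ge0.
rewrite -[leRHS]ger0_norm // -sqrtr_sqr ler_wsqrtr //.
have -> : \sum_i (u i + v i) ^+ 2 = a + b + 2 * \sum_i u i * v i.
  rewrite /a /b mulr_sumr -!big_split /=.
  by apply: eq_bigr => i _; ring.
have cab : \sum_i u i * v i <= Num.sqrt a * Num.sqrt b.
  rewrite -sqrtrM ?sum_ge0 //.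
  by rewrite (le_trans (ler_norm _)) // -sqrtr_sqr ler_wsqrtr // sum_mul_sqr_le.
rewrite sqrrD !sqr_sqrtr ?sum_ge0 //.
lra.
Qed.

Variables m n : nat.
Implicit Types A B : 'M[R]_(m, n).

Lemma fnormE A :
  fnorm A = Num.sqrt (\sum_(ij : 'I_m * 'I_n) A ij.1 ij.2 ^+ 2).
Proof. by rewrite /fnorm pair_big. Qed.

Lemma fnorm_ge0 A : 0 <= fnorm A.
Proof. exact: sqrtr_ge0. Qed.

Lemma sqr_fnorm A : fnorm A ^+ 2 = \sum_(i < m) \sum_(j < n) A i j ^+ 2.
Proof.
by rewrite sqr_sqrtr //; apply: sumr_ge0 => i _; apply: sumr_ge0 => j _; exact: sqr_ge0.
Qed.

Lemma fnorm0 : fnorm (0 : 'M[R]_(m, n)) = 0.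
Proof.
rewrite /fnorm big1 ?sqrtr0 // => i _; rewrite big1 // => j _.
by rewrite mxE expr0n.
Qed.

Lemma fnormZ (c : R) A : fnorm (c *: A) = `|c| * fnorm A.
Proof.
rewrite /fnorm -sqrtr_sqr -sqrtrM ?sqr_ge0 // mulr_sumr; congr Num.sqrt.
apply: eq_bigr => i _; rewrite mulr_sumr; apply: eq_bigr => j _.
by rewrite mxE exprMn.
Qed.

Lemma fnorm_distC A B : fnorm (A - B) = fnorm (B - A).
Proof. by rewrite -opprB -scaleN1r fnormZ normrN1 mul1r. Qed.

Lemma fnormD A B : fnorm (A + B) <= fnorm A + fnorm B.
Proof.
rewrite !fnormE; under eq_bigr do rewrite mxE; exact: sqrt_sum_sqrD.
Qed.

Lemma fnorm_distD A B D : fnorm (A - D) <= fnorm (A - B) + fnorm (B - D).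
Proof. by rewrite (le_trans _ (fnormD _ _)) // addrA subrK. Qed.

Lemma fnorm_leD A B : fnorm A <= fnorm B + fnorm (A - B).
Proof. by rewrite (le_trans _ (fnormD _ _)) // addrC subrK. Qed.

Lemma fnorm_telescope (g : nat -> 'M[R]_(m, n)) (j : nat) :
  fnorm (g j - g 0%N) <= \sum_(i < j) fnorm (g i.+1 - g i).
Proof.
elim: j => [|j IH]; first by rewrite subrr fnorm0 big_ord0.
rewrite big_ord_recr /= addrC.
by rewrite (le_trans (fnorm_distD _ (g j) _)) // lerD2l.
Qed.

End FrobeniusNorm.

(** * Norm of a pair against the norms of its components *)

Section FrobeniusNormRow.
Variables (R : realType) (r m n : nat) (A : 'M[R]_(r, m)) (B : 'M[R]_(r, n)).

Lemma sqr_fnorm_row_mx : fnorm (row_mx A B) ^+ 2 = fnorm A ^+ 2 + fnorm B ^+ 2.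
Proof.
rewrite !sqr_fnorm -big_split /=; apply: eq_bigr => i _.
rewrite big_split_ord /=; congr (_ + _); apply: eq_bigr => j _.
- by rewrite row_mxEl.
- by rewrite row_mxEr.
Qed.

Lemma fnorm_row_mxl : fnorm A <= fnorm (row_mx A B).
Proof.
rewrite -(@ler_pXn2r _ 2) ?nnegrE ?fnorm_ge0 // sqr_fnorm_row_mx.
by rewrite lerDl sqr_ge0.
Qed.

Lemma fnorm_row_mxr : fnorm B <= fnorm (row_mx A B).
Proof.
rewrite -(@ler_pXn2r _ 2) ?nnegrE ?fnorm_ge0 // sqr_fnorm_row_mx.
by rewrite lerDr sqr_ge0.
Qed.

Lemma fnorm_row_mx_le : fnorm (row_mx A B) <= fnorm A + fnorm B.
Proof.
rewrite -(@ler_pXn2r _ 2) ?nnegrE ?addr_ge0 ?fnorm_ge0 // sqr_fnorm_row_mx.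
have := fnorm_ge0 A; have := fnorm_ge0 B; nra.
Qed.

End FrobeniusNormRow.

(** * Convolution of the one-step errors with a summable contraction rate *)

Section Convolution.
Variables (R : realType) (gamma : nat -> R) (C : R).
Hypothesis gamma_ge0 : forall t, 0 <= gamma t.
Hypothesis gamma_le : forall N, \sum_(i < N) gamma i <= C.
Variable e : nat -> R.

Definition convolution (t : nat) : R := \sum_(i < t) gamma (t - i.+1) * e i.

(** The weights sum to at most [C] and each error is at most [r / C]. If [C] is zero, every
    [gamma i] vanishes, and so does the convolution. *)
Lemma convolution_le (r : R) (t : nat) :
  0 <= r -> (forall i, (i < t)%N -> C * e i <= r) -> convolution t <= r.
Proof.
move=> r0 Ce.
have C0 : 0 <= C by have := gamma_le 0; rewrite big_ord0.
have sumg : \sum_(i < t) gamma (t - i.+1) <= C.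
  (* Reversing the index turns the weights into [gamma 0], ..., [gamma (t - 1)]. *)
  rewrite (reindex_inj rev_ord_inj) /= (le_trans _ (gamma_le t)) //.
  by rewrite ler_sum // => i _; rewrite subnSK // subKn // ltnW.
case: (ltP 0 C) => [Cpos|Cle0].
  rewrite (@le_trans _ _ (\sum_(i < t) gamma (t - i.+1) * (r / C))) //.
    apply: ler_sum => i _; apply: ler_wpM2l => //.
    by rewrite ler_pdivlMr // mulrC Ce.
  by rewrite -mulr_suml mulrCA ler_piMr // ler_pdivrMr // mul1r.
have g0 i : gamma i = 0.
  apply: le_anti; rewrite gamma_ge0 andbT.
  rewrite (le_trans _ Cle0) // (le_trans _ (gamma_le i.+1)) //.
  by rewrite big_ord_recr /= lerDr sumr_ge0.
by rewrite /convolution big1 // => i _; rewrite g0 mul0r.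
Qed.

(** Discrete Young inequality: after exchanging the sums, [e i] carries the total weight of
    [gamma 0], ..., [gamma (T - 1 - i)], which is at most [C]. *)
Lemma sum_convolution_le (T : nat) :
  (forall i, (i < T)%N -> 0 <= e i) ->
  \sum_(t < T) convolution t.+1 <= C * \sum_(i < T) e i.
Proof.
move=> e0.
have -> : \sum_(t < T) convolution t.+1
    = \sum_(0 <= t < T) \sum_(0 <= i < T | (i < t.+1)%N) gamma (t - i) * e i.
  rewrite big_mkord; apply: eq_bigr => t _.
  rewrite /convolution -(big_mkord xpredT (fun i => gamma (t.+1 - i.+1) * e i)).
  by rewrite (@big_nat_widen _ _ _ 0 t.+1 T) /=.
rewrite (@exchange_big_dep_nat _ _ _ _ _ _ _ _ _ xpredT) //= mulr_sumr big_mkord.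
apply: ler_sum => i _; rewrite -mulr_suml; apply: ler_wpM2r; first exact: e0.
have -> : \sum_(0 <= t < T | (i < t.+1)%N) gamma (t - i)
    = \sum_(i <= t < T) gamma (t - i) by rewrite (big_nat_widenl i 0).
rewrite -{1}[i : nat]add0n big_addn big_mkord.
rewrite (le_trans _ (gamma_le (T - i))) //.
by apply: ler_sum => t _; rewrite addnK.
Qed.

End Convolution.

(** * The exact partial system as a flow *)

Section ExactFlow.
Variables (R : realType) (n m d p : nat) (q : dynamics R n m d p).
Variable astar : nat -> 'rV[R]_p.

Definition exact_step (th : nat -> 'rV[R]_d) (t : nat)
    (z : 'rV[R]_n * 'rV[R]_m) : 'rV[R]_n * 'rV[R]_m :=
  (qx q t z.1 z.2 (th t) (astar t), qy q t z.1 z.2 (th t) (astar t)).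

(* State at absolute time [t] when started from [z] at time [tau <= t];
   for [t < tau] it is [z]. *)
Definition exact_flow (th : nat -> 'rV[R]_d) (tau : nat)
    (z : 'rV[R]_n * 'rV[R]_m) (t : nat) : 'rV[R]_n * 'rV[R]_m :=
  iteri (t - tau) (fun k => exact_step th (tau + k)) z.

Lemma exact_flow_start th tau z : exact_flow th tau z tau = z.
Proof. by rewrite /exact_flow subnn. Qed.

Lemma exact_flowS th tau z t : (tau <= t)%N ->
  exact_flow th tau z t.+1 = exact_step th t (exact_flow th tau z t).
Proof. by move=> le_tau; rewrite /exact_flow subSn //= subnKC. Qed.

Lemma exact_flow_partial_traj T th tau s z : (tau <= s)%N ->
  partial_traj T q astar th s
    (fun t => (exact_flow th tau z t).1) (fun t => (exact_flow th tau z t).2).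
Proof.
move=> tau_s t /andP[s_t _].
by rewrite exact_flowS // (leq_trans tau_s).
Qed.

Lemma partial_traj_flow T th tau x y : partial_traj T q astar th tau x y ->
  forall t, (tau <= t <= T)%N -> exact_flow th tau (x tau, y tau) t = (x t, y t).
Proof.
move=> tr; elim=> [|t IH] /andP[].
  by rewrite leqn0 => /eqP -> _; rewrite exact_flow_start.
rewrite leq_eqVlt => /predU1P[<- _|]; first by rewrite exact_flow_start.
rewrite ltnS => tau_t t_T; rewrite exact_flowS // IH ?tau_t 1?ltnW //.
by have [|-> ->] := tr t; rewrite ?tau_t.
Qed.

(** Contraction Stability speaks of trajectories up to the full horizon; the flow continues a
    shorter one beyond [S]. *)
Lemma partial_traj_extend S th tau x y : (tau <= S)%N ->
  partial_traj S q astar th tau x y ->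
  exists x' y', [/\ (forall T, partial_traj T q astar th tau x' y'),
    (forall t, (tau <= t <= S)%N -> x' t = x t)
    & (forall t, (tau <= t <= S)%N -> y' t = y t)].
Proof.
move=> tau_S tr; set F := exact_flow th tau (x tau, y tau).
exists (fun t => (F t).1), (fun t => (F t).2); split.
- by move=> T; exact: exact_flow_partial_traj.
- by move=> t tS; rewrite /F (partial_traj_flow tr).
- by move=> t tS; rewrite /F (partial_traj_flow tr).
Qed.

Lemma eq_partial_traj T th th' tau x y :
  (forall t, (t < T)%N -> th t = th' t) ->
  partial_traj T q astar th tau x y -> partial_traj T q astar th' tau x y.
Proof.
by move=> thE tr t /andP[tau_t t_T]; rewrite -thE //; apply: tr; rewrite tau_t.
Qed.

(** * Contraction Stability on shorter horizons *)

Section Truncation.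
Variables (Theta : set 'rV[R]_d) (eps_th : R) (S T : nat).
Hypotheses (eps_th_ge0 : 0 <= eps_th) (ltST : (S < T)%N).

(** From time [S] on the increments are 0, which [eps_th_ge0] allows. *)
Lemma slowly_varying_freeze th : slowly_varying S.+1 Theta eps_th th ->
  slowly_varying T Theta eps_th (fun t => th (minn t S)).
Proof.
case=> thT thS; split=> t tT; first by apply: thT; rewrite ltnS geq_minr.
case: (ltnP t S) => [tS|St].
  by rewrite (minn_idPl tS); exact: thS.
by rewrite (minn_idPr (leqW St)) subrr fnorm0.
Qed.

Lemma partial_traj_freeze th tau x y :
  partial_traj S.+1 q astar th tau x y ->
  partial_traj S.+1 q astar (fun t => th (minn t S)) tau x y.
Proof.
by apply: eq_partial_traj => t; rewrite ltnS => /minn_idPl ->.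
Qed.

(** States up to time [S.+1] depend only on [th 0], ..., [th S], which freezing leaves unchanged;
    the extended trajectory then obeys the bound at horizon [T]. *)
Lemma stable_from_trunc Rxs Rys tau xi yi : (tau <= S.+1)%N ->
  stable_from T q Theta astar eps_th Rxs Rys tau xi yi ->
  stable_from S.+1 q Theta astar eps_th Rxs Rys tau xi yi.
Proof.
move=> tau_S st th x y sv tr x_tau y_tau t /andP[tau_t tS].
have [x' [y' [tr' xE yE]]] := partial_traj_extend tau_S (partial_traj_freeze tr).
rewrite -xE -?yE ?tau_t //.
apply: (st _ _ _ (slowly_varying_freeze sv) (tr' T)).
- by rewrite xE // leqnn.
- by rewrite yE // leqnn.
- by rewrite tau_t (leq_trans tS).
Qed.

(** The same [gamma] serves: both trajectories are extended under one frozen policy sequence and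
    compared at horizon [T]. *)
Lemma contraction_stability_trunc Rx Ry Rxs Rys C :
  contraction_stability T q Theta astar eps_th Rx Ry Rxs Rys C ->
  contraction_stability S.+1 q Theta astar eps_th Rx Ry Rxs Rys C.
Proof.
case=> Rx_lt Ry_lt st [gamma [g0 gC ct]]; split=> //.
  move=> tau tau_S; apply: stable_from_trunc => //; apply: st.
  exact: leq_trans tau_S ltST.
exists gamma; split=> // th tau x y x' y' sv tr tr' bx bx' by_ by' t tS.
have tau_S : (tau <= S.+1)%N := leq_trans (leq_addr _ _) tS.
have [X [Y [trX XE YE]]] := partial_traj_extend tau_S (partial_traj_freeze tr).
have [X' [Y' [trX' XE' YE']]] := partial_traj_extend tau_S (partial_traj_freeze tr').
have := ct _ _ _ _ _ _ (slowly_varying_freeze sv) (trX T) (trX' T).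
rewrite !XE ?YE ?XE' ?YE' ?leqnn // => /(_ bx bx' by_ by' t).
rewrite ?XE ?YE ?XE' ?YE' ?leq_addr //.
by apply; exact: leq_trans ltST.
Qed.

End Truncation.

(** * Robustness on shorter horizons *)

Section JointTruncation.
Variables (Theta : set 'rV[R]_d) (A : set 'rV[R]_p).

Definition joint_step (t : nat) (w : 'rV[R]_n * 'rV[R]_m * 'rV[R]_d) :=
  (exact_step (fun=> w.2) t w.1, qth q t w.1.1 w.1.2 w.2 (astar t)).

(* After time [S] the perturbations are switched off. *)
Lemma robustness_trunc S T x0 y0 th0 eps_th zbar Reg Rbound zeta x y th :
  (S <= T)%N -> 0 <= zbar ->
  preserves_Theta T q Theta A -> (forall t, (t < T)%N -> A (astar t)) ->
  robustness T q Theta astar x0 y0 th0 eps_th zbar Reg Rbound ->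
  x 0%N = x0 -> y 0%N = y0 -> th 0%N = th0 ->
  perturbed_traj S q Theta astar zeta x y th ->
  (forall t, (t < S)%N -> fnorm (zeta t) <= zbar) ->
  forall t, (t < S)%N -> fnorm (th t.+1 - th t) <= eps_th.
Proof.
move=> ST zbar0 presT Aastar rob x0E y0E th0E [thT tr] zle t tS.
(* [W] follows the given trajectory up to [S] and the unperturbed joint dynamics afterwards, so that
   Robustness at horizon [T] applies to it. *)
pose W t := if (t <= S)%N then (x t, y t, th t)
  else iteri (t - S) (fun k => joint_step (S + k)) (x S, y S, th S).
have W_le t' : (t' <= S)%N -> W t' = (x t', y t', th t') by rewrite /W => ->.
have WS t' : (S <= t')%N -> W t'.+1 = joint_step t' (W t').
  move=> St; rewrite /W ltnNge St /= subSn //= subnKC //.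
  by case: leqP => // tS'; rewrite (@anti_leq t' S) ?tS' // subnn.
pose zeta' t := if (t < S)%N then zeta t else 0.
have [|||||] := rob zeta' (fun t => (W t).1.1) (fun t => (W t).1.2) (fun t => (W t).2).
- by rewrite W_le.
- by rewrite W_le.
- by rewrite W_le.
- split.
    elim=> [_|t' IH t'T]; first by rewrite W_le //=; exact: thT.
    case: (ltnP t' S) => [t'S|St']; first by rewrite W_le //=; exact: thT.
    (* Without perturbation the policy parameter stays in [Theta] by invariance. *)
    by rewrite WS //=; apply: presT => //; [exact/IH/ltnW | exact: Aastar].
  move=> t' t'T; rewrite /zeta'; case: ltnP => [t'S|St'].
    by rewrite !W_le ?(ltnW t'S) //=; exact: tr.
  by rewrite WS //= addr0.
- by move=> t' _; rewrite /zeta'; case: ifP => [/zle //|_]; rewrite fnorm0.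
- move=> /(_ t (leq_trans tS ST)) + _.
  by rewrite !W_le ?(ltnW tS).
Qed.

End JointTruncation.
End ExactFlow.

(** * Deviation from the exact system under slowly varying policy parameters *)

Section Tracking.
Variables (R : realType) (n m d p T : nat) (q : dynamics R n m d p).
Variables (Theta : set 'rV[R]_d) (astar : nat -> 'rV[R]_p).
Variables (eps_th Rx Ry Rxs Rys C : R) (gamma : nat -> R).
Variables (th : nat -> 'rV[R]_d) (x : nat -> 'rV[R]_n) (y : nat -> 'rV[R]_m).
Variables (xt : nat -> 'rV[R]_n) (yt : nat -> 'rV[R]_m) (e : nat -> R).

Hypothesis th_slow : slowly_varying T Theta eps_th th.
Hypotheses (Rxs_lt : Rxs < Rx) (Rys_lt : Rys < Ry).
Hypothesis stable0 : stable_from T q Theta astar eps_th Rxs Rys T 0 0.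
Hypothesis gamma_ge0 : forall t, 0 <= gamma t.
Hypothesis gamma_le : forall N, \sum_(i < N) gamma i <= C.
Hypothesis contract : forall tau x y x' y',
  partial_traj T q astar th tau x y -> partial_traj T q astar th tau x' y' ->
  fnorm (x tau) <= Rx -> fnorm (x' tau) <= Rx ->
  fnorm (y tau) <= Ry -> fnorm (y' tau) <= Ry ->
  forall t, (tau + t <= T)%N ->
  fnorm (row_mx (x (tau + t)%N) (y (tau + t)%N)
         - row_mx (x' (tau + t)%N) (y' (tau + t)%N))
  <= gamma t * fnorm (row_mx (x tau) (y tau) - row_mx (x' tau) (y' tau)).
Hypothesis traj_t : partial_traj T q astar th 0 xt yt.
Hypotheses (xt0 : xt 0%N = x 0%N) (yt0 : yt 0%N = y 0%N).
Hypothesis stable_init :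
  stable_from T q Theta astar eps_th Rxs Rys 0 (x 0%N) (y 0%N).
Hypothesis one_step : forall t, (t < T)%N ->
  fnorm (x t) <= Rx -> fnorm (y t) <= Ry ->
  fnorm (row_mx (x t.+1) (y t.+1)
         - row_mx (qx q t (x t) (y t) (th t) (astar t))
                  (qy q t (x t) (y t) (th t) (astar t))) <= e t.
Hypothesis e_le : forall t, (t < T)%N -> C * e t <= Num.min (Rx - Rxs) (Ry - Rys).

Lemma partial_traj_end x' y' : partial_traj T q astar th T x' y'.
Proof. by move=> t /andP[Tt]; rewrite ltnNge Tt. Qed.

(* Two starting points compared at elapsed time 0 give [1 <= gamma 0]; the form
   below also covers a zero-dimensional state space. *)
Lemma gamma0_expands (a : 'rV[R]_n) (b : 'rV[R]_m) :
  fnorm (row_mx a b) <= gamma 0 * fnorm (row_mx a b).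
Proof.
(* Stability of the zero state, read at the starting time [T] itself, gives nonnegative [Rxs] and
   [Rys]. *)
have [Rx0 Ry0] : 0 < Rx /\ 0 < Ry.
  have [] := stable0 th_slow (partial_traj_end (fun=> 0) (fun=> 0)) erefl erefl (t := T).
    by rewrite leqnn.
  rewrite !fnorm0 => Rx0 Ry0.
  by split; [exact: le_lt_trans Rxs_lt | exact: le_lt_trans Rys_lt].
set v := row_mx a b; have v0 : 0 < fnorm v + 1 by rewrite ltr_pwDr ?fnorm_ge0.
(* Scaling by [c] brings the pair into both balls, and [c] cancels in the end; the added 1 keeps the
   denominator positive when [v] is zero. *)
pose c := Num.min Rx Ry / (fnorm v + 1).
have c0 : 0 < c by rewrite divr_gt0 // lt_min Rx0.
have cv : c * fnorm v <= Num.min Rx Ry.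
  rewrite /c mulrAC ler_pdivrMr // ler_wpM2l ?lerDl //.
  by rewrite le_min !ltW.
move: cv; rewrite le_min => /andP[cvx cvy].
have nc k (u : 'rV[R]_k) : fnorm (c *: u) = c * fnorm u by rewrite fnormZ gtr0_norm.
have := contract (partial_traj_end (fun=> c *: a) (fun=> c *: b))
                 (partial_traj_end (fun=> 0) (fun=> 0)).
rewrite !fnorm0 => /(_ _ (ltW Rx0) _ (ltW Ry0) 0%N).
rewrite row_mx0 subr0 -scale_row_mx -/v !nc addn0 mulrCA ler_pM2l //; apply=> //.
- by rewrite (le_trans _ cvx) // ler_pM2l // fnorm_row_mxl.
- by rewrite (le_trans _ cvy) // ler_pM2l // fnorm_row_mxr.
Qed.

Let X j t := exact_flow q astar th j (x j, y j) t.

Let X_traj j s : (j <= s)%N ->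
  partial_traj T q astar th s (fun t => (X j t).1) (fun t => (X j t).2).
Proof. exact: exact_flow_partial_traj. Qed.

Let X0E t : (t <= T)%N -> X 0 t = (xt t, yt t).
Proof. by move=> tT; rewrite /X -xt0 -yt0 (partial_traj_flow traj_t). Qed.

Let XE j : X j j = (x j, y j).
Proof. exact: exact_flow_start. Qed.

Lemma exact_bounded t : (t <= T)%N -> fnorm (xt t) <= Rxs /\ fnorm (yt t) <= Rys.
Proof. exact: (stable_init th_slow traj_t). Qed.

Let ball j t := fnorm (X j t).1 <= Rx /\ fnorm (X j t).2 <= Ry.

(* Restarting the exact flow from [(x j, y j)] for successive [j] splits the
   deviation at time [t] into one-step errors contracted over the remaining time. *)
Let deviation t j : (t <= T)%N -> (j <= t)%N ->
  (forall s i, (s < t)%N -> (i <= s)%N -> ball i s) ->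
  fnorm (row_mx (X j t).1 (X j t).2 - row_mx (xt t) (yt t))
  <= \sum_(i < j) gamma (t - i.+1) * e i.
Proof.
move=> tT jt IH.
(* The telescope runs from [X 0], the exact trajectory, to [X j]. The flows [X i] and [X i.+1]
   differ at time [i.+1] by the one-step error alone. *)
have := fnorm_telescope (fun i => row_mx (X i t).1 (X i t).2) j.
rewrite X0E // => /le_trans; apply; apply: ler_sum => -[i ij] _ /=.
have it : (i < t)%N := leq_trans ij jt.
have iT : (i < T)%N := leq_trans it tT.
have [bx by_] : fnorm (x i) <= Rx /\ fnorm (y i) <= Ry.
  by have := IH i i it (leqnn i); rewrite /ball XE.
have := one_step iT bx by_.
rewrite -[qx _ _ _ _ _ _]/(exact_step q astar th i (x i, y i)).1.
rewrite -[qy _ _ _ _ _ _]/(exact_step q astar th i (x i, y i)).2.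
rewrite -(XE i) -exact_flowS // -/(X i i.+1) => le_e.
apply: (@le_trans _ _ (gamma (t - i.+1) *
    fnorm (row_mx (x i.+1) (y i.+1) - row_mx (X i i.+1).1 (X i i.+1).2))); last first.
  exact: ler_wpM2l.
(* When [i.+1 = t] no time remains to contract, and the state at [t] is not yet known to lie in the
   balls; [gamma0_expands] supplies the factor [gamma 0]. *)
case: (ltngtP i.+1 t) it => // [it _|<- _]; last first.
  by rewrite XE subnn opp_row_mx add_row_mx gamma0_expands.
have := contract (X_traj (leqnn i.+1)) (X_traj (leqnSn i)) _ _ _ _ (t := (t - i.+1)%N).
rewrite subnKC ?(ltnW it) // !XE /=; apply=> //.
- by have := IH i.+1 i.+1 it (leqnn _); rewrite /ball XE => -[].
- by have [] := IH i.+1 i it (leqnSn _).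
- by have := IH i.+1 i.+1 it (leqnn _); rewrite /ball XE => -[].
- by have [] := IH i.+1 i it (leqnSn _).
Qed.

(** Strong induction on time: the balls at earlier times validate [deviation], whose bound is at
    most the margin between [Rxs], [Rys] and [Rx], [Ry]; the exact trajectory stays within [Rxs] and
    [Rys]. *)
Let in_ball t : (t <= T)%N -> forall j, (j <= t)%N -> ball j t.
Proof.
elim/ltn_ind: t => t IH tT j jt.
have r0 : 0 <= Num.min (Rx - Rxs) (Ry - Rys) by rewrite le_min !subr_ge0 !ltW.
(* Setting the errors from [j] on to 0 makes the partial sum a full convolution at time [t]. *)
pose e' i := if (i < j)%N then e i else 0.
have : \sum_(i < j) gamma (t - i.+1) * e i <= Num.min (Rx - Rxs) (Ry - Rys).
  have <- : convolution gamma e' t = \sum_(i < j) gamma (t - i.+1) * e i.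
    rewrite /convolution -(big_mkord xpredT (fun i => gamma (t - i.+1) * e' i)).
    rewrite (big_cat_nat (leq0n j) jt) //= big_mkord [X in _ + X]big_nat_cond.
    rewrite [X in _ + X]big1 ?addr0.
      by apply: eq_bigr => i _; rewrite /e' ltn_ord.
    by move=> i /andP[/andP[ji _] _]; rewrite /e' ltnNge ji mulr0.
  apply: (convolution_le gamma_ge0 gamma_le r0) => i it; rewrite /e'.
  by case: ifP => _; [exact/e_le/(leq_trans it) | rewrite mulr0].
have IH' s i : (s < t)%N -> (i <= s)%N -> ball i s.
  by move=> st; apply: IH => //; exact: ltnW (leq_trans st tT).
move=> /(le_trans (deviation tT jt IH')); rewrite opp_row_mx add_row_mx le_min.
case/andP=> /(le_trans (fnorm_row_mxl _ _)) dx /(le_trans (fnorm_row_mxr _ _)) dy.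
have [bx by_] := exact_bounded tT.
split.
- by have := fnorm_leD (X j t).1 (xt t); lra.
- by have := fnorm_leD (X j t).2 (yt t); lra.
Qed.

Lemma state_bounded t : (t <= T)%N -> fnorm (x t) <= Rx /\ fnorm (y t) <= Ry.
Proof. by move=> tT; have := in_ball tT (leqnn t); rewrite /ball XE. Qed.

Lemma deviation_le t : (t <= T)%N ->
  fnorm (row_mx (x t) (y t) - row_mx (xt t) (yt t)) <= convolution gamma e t.
Proof.
move=> tT; have := deviation tT (leqnn t); rewrite XE; apply=> s i st.
by apply: in_ball; exact: ltnW (leq_trans st tT).
Qed.

End Tracking.

(** * The tracking and regret guarantees of the meta-framework *)

Lemma le_ediv_mul (R : realType) (a b e : R) : 0 <= a -> 0 <= b ->
  (e%:E <= a%:E / b%:E)%E -> b * e <= a.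
Proof.
move=> a0; rewrite le_eqVlt => /predU1P[<- _|b0]; first by rewrite mul0r.
by rewrite inver gt_eqF // -EFinM lee_fin ler_pdivlMr // mulrC.
Qed.

Lemma convolutionZ (R : realType) (gamma e : nat -> R) (c : R) (t : nat) :
  convolution gamma (fun i => c * e i) t = c * convolution gamma e t.
Proof. by rewrite /convolution mulr_sumr; apply: eq_bigr => i _; rewrite mulrCA. Qed.

Theorem theorem6 (R : realType) (n m d p k T : nat)
    (Theta : set 'rV[R]_d) (A : set 'rV[R]_p)
    (f : nat -> 'rV[R]_n -> 'rV[R]_p -> 'rV[R]_k)
    (q : dynamics R n m d p)
    (astar ahat : nat -> 'rV[R]_p)
    (x0 : 'rV[R]_n) (y0 : 'rV[R]_m) (th0 : 'rV[R]_d)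
    (alx aly alth bex bey beth Lx Ly Rx Ry Rxs Rys C eps_th zbar : R)
    (Reg : ('I_T.+1 -> 'rV[R]_n * 'rV[R]_m * 'rV[R]_d) -> R)
    (Rbound : nat -> R -> R)
    (x : nat -> 'rV[R]_n) (y : nat -> 'rV[R]_m) (th : nat -> 'rV[R]_d)
    (xt : nat -> 'rV[R]_n) (yt : nat -> 'rV[R]_m) (zeta : nat -> 'rV[R]_d) :
  let eps t := mismatch f t (x t) (ahat t) (astar t) in
  let eps' t := mismatch' f t (x t) (ahat t) (astar t) in
  closed Theta -> convex_set Theta ->
  (forall t a z, (t < T)%N -> A a -> differentiable (fun z' => f t z' a) z) ->
  preserves_Theta T q Theta A ->
  (forall t, (t < T)%N -> A (astar t) /\ A (ahat t)) ->
  Theta th0 ->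
  0 <= Lx -> 0 <= Ly -> 0 <= eps_th -> 0 <= zbar ->
  lipschitzness T f q Theta A astar alx aly alth bex bey beth Lx Ly Rx Ry ->
  contraction_stability T q Theta astar eps_th Rx Ry Rxs Rys C ->
  stable_from T q Theta astar eps_th Rxs Rys 0 x0 y0 ->
  robustness T q Theta astar x0 y0 th0 eps_th zbar Reg Rbound ->
  x 0%N = x0 -> y 0%N = y0 -> th 0%N = th0 ->
  (forall t, (t < T)%N ->
     [/\ x t.+1 = qx q t (x t) (y t) (th t) (ahat t),
         y t.+1 = qy q t (x t) (y t) (th t) (ahat t)
       & th t.+1 = qth q t (x t) (y t) (th t) (ahat t)]) ->
  (forall t, (t < T)%N ->
     alth * eps t + beth * eps' t <= zbar / 2) ->
  (* extended-real division: a bound with a zero denominator and a positive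
     numerator is +oo *)
  (forall t, (t < T)%N ->
     (((alx + aly) * eps t + (bex + bey) * eps' t)%:E
      <= mine ((Num.sqrt 2 * zbar)%:E / (4 * (Lx + Ly) * C)%:E)
              ((Num.min (Rx - Rxs) (Ry - Rys))%:E / C%:E))%E) ->
  xt 0%N = x0 -> yt 0%N = y0 ->
  partial_traj T q astar th 0 xt yt ->
  (forall t, (t < T)%N ->
     zeta t = th t.+1 - qth q t (xt t) (yt t) (th t) (astar t)) ->
  [/\ (forall t, (t <= T)%N -> fnorm (x t) <= Rx /\ fnorm (y t) <= Ry),
      (forall t, (t < T)%N -> fnorm (th t.+1 - th t) <= eps_th),
      perturbed_traj T q Theta astar zeta xt yt th /\
      Reg (fun t => (xt t, yt t, th t))
        <= Rbound T (\sum_(t < T) fnorm (zeta t)),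
      \sum_(t < T) fnorm (zeta t)
        <= (alth + Num.sqrt 2 * C * (Lx + Ly) * (alx + aly))
             * (\sum_(t < T) eps t)
           + (beth + Num.sqrt 2 * C * (Lx + Ly) * (bex + bey))
             * (\sum_(t < T) eps' t)
    & \sum_(1 <= t < T.+1) fnorm (row_mx (x t) (y t) - row_mx (xt t) (yt t))
        <= C * ((alx + aly) * (\sum_(t < T) eps t)
                + (bex + bey) * (\sum_(t < T) eps' t))].
Proof.
move=> eps eps' _ _ _ presT aA Theta0 Lx0 Ly0 eps_th0 zbar0 [lip lipth] cs stab rob
  x0E y0E th0E dyn bnd_th bnd xt0E yt0E traj_t zetaE.
pose e t := (alx + aly) * eps t + (bex + bey) * eps' t.
pose b t := alth * eps t + beth * eps' t.
pose L := Lx + Ly.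
pose D t := fnorm (row_mx (x t) (y t) - row_mx (xt t) (yt t)).
have L0 : 0 <= L by exact: addr_ge0.
have ThetaP t : (t <= T)%N -> Theta (th t).
  elim: t => [_|t IH tT]; first by rewrite th0E.
  have [_ _ ->] := dyn t tT; have [_ Aahat] := aA t tT.
  by apply: presT => //; exact/IH/ltnW.
have [Rx_lt Ry_lt _ _] := cs.
have C0 : 0 <= C.
  have [_ _ _ [gamma [g0 gC _]]] := cs.
  by rewrite -lee_fin (le_trans _ gC) // nneseries_ge0 // => i _ _; rewrite lee_fin.
have r0 : 0 <= Num.min (Rx - Rxs) (Ry - Rys) by rewrite le_min !subr_ge0 !ltW.
have e_le t : (t < T)%N -> C * e t <= Num.min (Rx - Rxs) (Ry - Rys).
  by move=> /bnd; rewrite le_min => /andP[_]; exact: le_ediv_mul.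
have sqrt2_ge1 : 1 <= Num.sqrt 2 :> R by rewrite -{1}sqrtr1 ler_wsqrtr // ler1n.
have sqrt2_le2 : Num.sqrt 2 <= 2 :> R.
  by rewrite -[leRHS]ger0_norm // -sqrtr_sqr ler_wsqrtr // expr2 ler_pMr // ler1n.
(* The first bound in the minimum gives [Num.sqrt 2 * zbar / 4], and [Num.sqrt 2 <= 2]. *)
have Le_le t : (t < T)%N -> C * (L * e t) <= zbar / 2.
  move=> /bnd; rewrite le_min => /andP[+ _] => /le_ediv_mul.
  rewrite mulr_ge0 ?sqrtr_ge0 // !mulr_ge0 // => /(_ isT isT).
  rewrite -/L -/(e t) => H.
  have : Num.sqrt 2 * zbar <= 2 * zbar by exact: ler_wpM2r.
  have -> : C * (L * e t) = (4 * L * C * e t) / 4 by field.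
  lra.
have lipP t : (t < T)%N -> fnorm (x t) <= Rx -> fnorm (y t) <= Ry ->
  [/\ fnorm (qx q t (x t) (y t) (th t) (astar t) - x t.+1)
        + fnorm (qy q t (x t) (y t) (th t) (astar t) - y t.+1) <= e t
    & fnorm (qth q t (x t) (y t) (th t) (astar t) - th t.+1) <= b t].
  move=> tT bx by_; have [-> -> ->] := dyn t tT; have [_ Aahat] := aA t tT.
  have [lx ly lt] := lip t _ _ (th t) _ tT bx by_ (ThetaP t (ltnW tT)) Aahat.
  by split=> //; rewrite (le_trans (lerD lx ly)) // /e /eps /eps'; lra.
(* The horizon [S] is kept general: the induction for [slow] uses [track] at each partial horizon,
   the final estimates at [T]. *)
have track S : (S <= T)%N -> slowly_varying S Theta eps_th th ->
    contraction_stability S q Theta astar eps_th Rx Ry Rxs Rys C ->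
    stable_from S q Theta astar eps_th Rxs Rys 0 x0 y0 ->
  exists gamma : nat -> R, [/\ (forall t, 0 <= gamma t),
    (forall N, \sum_(i < N) gamma i <= C),
    (forall t, (t <= S)%N -> fnorm (x t) <= Rx /\ fnorm (y t) <= Ry),
    (forall t, (t <= S)%N -> fnorm (xt t) <= Rx /\ fnorm (yt t) <= Ry)
    & (forall t, (t <= S)%N -> D t <= convolution gamma e t)].
  move=> ST sv [_ _ st0 [gamma [g0 gC ct]]] st.
  have gamma_le N : \sum_(i < N) gamma i <= C.
    rewrite -lee_fin -sumEFin -(big_mkord xpredT (fun i => (gamma i)%:E)).
    by apply: le_trans gC; apply: nneseries_lim_ge => i _ _; rewrite lee_fin.
  have traj_S : partial_traj S q astar th 0 xt yt.
    by move=> t tS; apply: traj_t; exact: leq_trans ST.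
  have one_step t : (t < S)%N -> fnorm (x t) <= Rx -> fnorm (y t) <= Ry ->
    fnorm (row_mx (x t.+1) (y t.+1)
           - row_mx (qx q t (x t) (y t) (th t) (astar t))
                    (qy q t (x t) (y t) (th t) (astar t))) <= e t.
    move=> tS bx by_; have [le_e _] := lipP t (leq_trans tS ST) bx by_.
    rewrite fnorm_distC opp_row_mx add_row_mx.
    exact: le_trans (fnorm_row_mx_le _ _) le_e.
  have e_le_S t : (t < S)%N -> C * e t <= Num.min (Rx - Rxs) (Ry - Rys).
    by move=> tS; apply: e_le; exact: leq_trans tS ST.
  have xt0 : xt 0%N = x 0%N by rewrite xt0E.
  have yt0 : yt 0%N = y 0%N by rewrite yt0E.
  have stx : stable_from S q Theta astar eps_th Rxs Rys 0 (x 0%N) (y 0%N).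
    by rewrite x0E y0E.
  have ctS tau X Y X' Y' := @ct th tau X Y X' Y' sv.
  exists gamma; split=> // t tS.
  - exact: (state_bounded sv Rx_lt Ry_lt (st0 S (leqnn S)) g0 gamma_le ctS traj_S
             xt0 yt0 stx one_step e_le_S).
  - have [bx by_] := exact_bounded sv traj_S xt0 yt0 stx tS.
    by split; [exact: le_trans bx (ltW _) | exact: le_trans by_ (ltW _)].
  - exact: (deviation_le sv Rx_lt Ry_lt (st0 S (leqnn S)) g0 gamma_le ctS traj_S
             xt0 yt0 stx one_step e_le_S).
(* Inserting the exact policy update at [(x t, y t)] separates the model error [b t] from the
   Lipschitz effect of the state deviation. *)
have zeta_le t : (t < T)%N -> fnorm (x t) <= Rx /\ fnorm (y t) <= Ry ->
    fnorm (xt t) <= Rx /\ fnorm (yt t) <= Ry -> fnorm (zeta t) <= b t + L * D t.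
  move=> tT [bx by_] [bxt byt]; rewrite zetaE //.
  rewrite (le_trans (fnorm_distD _ (qth q t (x t) (y t) (th t) (astar t)) _)) //.
  have [_ le_b] := lipP t tT bx by_.
  rewrite lerD // ?(fnorm_distC (th t.+1)) //.
  rewrite (le_trans (lipth t _ _ _ _ _ tT bx by_ bxt byt (ThetaP t (ltnW tT)))) //.
  rewrite /L /D opp_row_mx add_row_mx mulrDl.
  by rewrite lerD // ler_wpM2l // ?fnorm_row_mxl ?fnorm_row_mxr.
have pert S : (S <= T)%N -> perturbed_traj S q Theta astar zeta xt yt th.
  move=> ST; split=> t tS; first exact/ThetaP/(leq_trans tS).
  have tT := leq_trans tS ST; have [|xE yE] := traj_t t; first by rewrite tT.
  by split=> //; rewrite zetaE // addrC subrK.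
have zbar_le S : (S <= T)%N -> slowly_varying S Theta eps_th th ->
    contraction_stability S q Theta astar eps_th Rx Ry Rxs Rys C ->
    stable_from S q Theta astar eps_th Rxs Rys 0 x0 y0 ->
    forall t, (t < S)%N -> fnorm (zeta t) <= zbar.
  move=> ST sv csS stS t tS.
  have [gamma [g0 gC bx bxt dev]] := track S ST sv csS stS.
  have tT := leq_trans tS ST.
  rewrite (le_trans (zeta_le t tT (bx t (ltnW tS)) (bxt t (ltnW tS)))) //.
  (* The state deviation may use one half of [zbar]; the model error takes the other. *)
  have : L * D t <= zbar / 2.
    rewrite (le_trans (ler_wpM2l L0 (dev t (ltnW tS)))) // -convolutionZ.
    apply: (convolution_le g0 gC) => [|i it]; first by rewrite divr_ge0.
    exact/Le_le/(ltn_trans it).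
  have := bnd_th t tT; rewrite -/(b t); lra.
(* Increments up to [th S] make the sequence slowly varying at horizon [S.+1]. This bounds [zeta 0],
   ..., [zeta S], and Robustness then controls the next increment, from [th S] to [th S.+1]. *)
have slow S : (S <= T)%N -> forall t, (t < S)%N -> fnorm (th t.+1 - th t) <= eps_th.
  elim: S => // S IH ST.
  have Aastar t (tT : (t < T)%N) : A (astar t) by have [] := aA t tT.
  apply: (robustness_trunc ST zbar0 presT Aastar rob xt0E yt0E th0E (pert _ ST)).
  apply: zbar_le => //.
  - split=> t tS; first exact/ThetaP/ltnW/(leq_trans tS).
    by apply: IH => //; exact: ltnW.
  - exact: contraction_stability_trunc cs.
  - exact: stable_from_trunc stab.
have sv : slowly_varying T Theta eps_th th.
  split=> t tT; first exact/ThetaP/ltnW.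
  by apply: (slow T) => //; exact: ltnW.
have [gamma [g0 gC bx bxt dev]] := track T (leqnn T) sv cs stab.
(* The sign comes from [lipP], where [e t] dominates a sum of two norms. *)
have e0 t : (t < T)%N -> 0 <= e t.
  move=> tT; have [bxt' byt'] := bx t (ltnW tT).
  have [le_e _] := lipP t tT bxt' byt'.
  by rewrite (le_trans _ le_e) // addr_ge0 ?fnorm_ge0.
have sum_e : \sum_(t < T) e t
    = (alx + aly) * (\sum_(t < T) eps t) + (bex + bey) * (\sum_(t < T) eps' t).
  by rewrite !mulr_sumr -big_split.
have sum_D : \sum_(1 <= t < T.+1) D t <= C * \sum_(t < T) e t.
  rewrite big_add1 /= big_mkord (le_trans _ (sum_convolution_le gC e0)) //.
  by apply: ler_sum => t _; exact: dev.
have [_ regret] := rob _ _ _ _ xt0E yt0E th0E (pert T (leqnn T)) (zbar_le T (leqnn T) sv cs stab).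
split=> //; [exact: slow | by split=> //; exact: pert | | by rewrite -sum_e].
have : \sum_(t < T) fnorm (zeta t) <= \sum_(t < T) (b t + L * D t).
  by apply: ler_sum => t _; apply: zeta_le => //; [exact/bx/ltnW | exact/bxt/ltnW].
move=> /le_trans; apply.
(* Both trajectories start at the same state, so the sum over times 0 to [T - 1] is at most the one
   over 1 to [T]. *)
have D0 : D 0%N = 0 by rewrite /D x0E y0E xt0E yt0E subrr fnorm0.
have sum_D' : \sum_(t < T) D t <= C * \sum_(t < T) e t.
  rewrite (le_trans _ sum_D) // -(big_mkord xpredT D).
  rewrite -[leRHS]add0r -[X in _ <= X + _]D0 -big_ltn // big_nat_recr //= lerDl.
  exact: fnorm_ge0.
rewrite big_split /= -mulr_sumr big_split /= -!mulr_sumr.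
have sume0 : 0 <= \sum_(t < T) e t by apply: sumr_ge0 => t _; exact: e0.
(* The factor [Num.sqrt 2] enters only here, through [1 <= Num.sqrt 2]. *)
have : L * \sum_(t < T) D t <= Num.sqrt 2 * C * L * \sum_(t < T) e t.
  rewrite (le_trans (ler_wpM2l L0 sum_D')) //.
  have -> : L * (C * \sum_(t < T) e t) = 1 * (C * L * \sum_(t < T) e t) by ring.
  have -> : Num.sqrt 2 * C * L * (\sum_(t < T) e t)
    = Num.sqrt 2 * (C * L * \sum_(t < T) e t) by ring.
  by rewrite ler_wpM2r // !mulr_ge0.
rewrite sum_e -/L; lra.
Qed.
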